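(* Let $(\mathbf c^k)_{k\in\mathbb N}$, $(\tilde{\mathbf c}^k)_{k\in\mathbb N}$ be generated by any one of the seven Lagrangian-based schemes LAG-I, ..., LAG-VII (listed in the context, with the listed conditions on $\mathbf M,\mathbf\Omega,\mathbf\Gamma$). Let $B_1\subset\mathbb R^N$, $B_2\subset\mathbb R^M$, $B_3\subset\mathbb R^M$ be such that $B_1\times B_2\times B_3$ is bounded. Then for every $k\ge1$ the primal-dual gap restricted to $B_1\times B_2\times B_3$ satisfies $$\Psi_{B_1\times B_2\times B_3}\Big(\frac1k\sum_{i=0}^{k-1}\tilde{\mathbf c}^i\Big)\le\frac1{2k}\sup_{\mathbf c\in B_1\times B_2\times B_3}\big\|\mathbf c^0-\mathbf c\big\|_{\mathcal S}^2 .$$ Furthermore, $\Psi_{B_1\times B_2\times B_3}\big(\frac1k\sum_{i=0}^{k-1}\tilde{\mathbf c}^i\big)\ge0$ if $B_1\times B_2\times B_3$ contains a saddle point $\mathbf c^\star=(\mathbf x^\star,\mathbf a^\star,\mathbf p^\star)\in\mathrm{zer}\,\mathcal A$.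
   Context: Let $f:\mathbb R^N\to\mathbb R\cup\{+\infty\}$ and $g:\mathbb R^M\to\mathbb R\cup\{+\infty\}$ be proper, lower semicontinuous and convex, and $\mathbf A:\mathbb R^N\to\mathbb R^M$ linear. The Lagrangian is $\mathcal L(\mathbf x,\mathbf a,\mathbf p)=f(\mathbf x)+g(\mathbf a)+\langle\mathbf p,\mathbf A\mathbf x-\mathbf a\rangle$. Write $\mathbf c=(\mathbf x,\mathbf a,\mathbf p)\in\mathbb R^N\times\mathbb R^M\times\mathbb R^M$. The primal-dual gap restricted to $B_1\times B_2\times B_3$ is $$\Psi_{B_1\times B_2\times B_3}(\mathbf c)=\sup_{\mathbf p'\in B_3}\mathcal L(\mathbf x,\mathbf a,\mathbf p')-\inf_{(\mathbf x',\mathbf a')\in B_1\times B_2}\mathcal L(\mathbf x',\mathbf a',\mathbf p).$$ $\mathbb S_+$ (resp. $\mathbb S_{++}$) denotes symmetric positive semidefinite (resp. definite) matrices; $X\succ Y$ means $X-Y\in\mathbb S_{++}$; $\|\mathbf c\|_{\mathcal S}^2=\langle\mathbf c,\mathcal S\mathbf c\rangle$; $\mathbf I$ is the identity. $\mathbf M$ ($N\times N$), $\mathbf\Omega,\mathbf\Gamma$ ($M\times M$) are symmetric matrices (proximal metrics). Let $$\mathcal A=\begin{bmatrix}\partial f&0&\mathbf A^\top\\0&\partial g&-\mathbf I\\-\mathbf A&\mathbf I&0\end{bmatrix},\qquad \mathrm{zer}\,\mathcal A=\{\mathbf c:0\in\mathcal A\mathbf c\}.$$ Each scheme is a generalized proximal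 point algorithm $$0\in\mathcal A\tilde{\mathbf c}^k+\mathcal Q(\tilde{\mathbf c}^k-\mathbf c^k),\qquad \mathbf c^{k+1}=\mathbf c^k+\mathcal M(\tilde{\mathbf c}^k-\mathbf c^k),$$ where $\tilde{\mathbf c}^k=(\tilde{\mathbf x}^k,\tilde{\mathbf a}^k,\tilde{\mathbf p}^k)$ is the proximal output, $\mathcal Q,\mathcal M$ are given below, and $\mathcal S=\mathcal Q\mathcal M^{-1}$. Iterates are assumed to exist. Notation for the explicit forms: $P_\varphi(B;\mathbf w)=\arg\min_{\mathbf u}\varphi(\mathbf u)+\frac12\langle\mathbf u,B\mathbf u\rangle-\langle\mathbf w,\mathbf u\rangle$, which equals $\mathrm{prox}_\varphi^{B}(B^{-1}\mathbf w)=\arg\min_{\mathbf u}\varphi(\mathbf u)+\frac12\|\mathbf u-B^{-1}\mathbf w\|_B^2$ when $B$ is invertible. LAG-I: $\mathcal Q=\begin{bmatrix}\mathbf M&0&-\mathbf A^\top\\0&\mathbf\Omega&\mathbf I\\-\mathbf A&\mathbf I&\mathbf\Gamma^{-1}\end{bmatrix}$, $\mathcal M=\mathbf I$; i.e. $\mathbf x^{k+1}=P_f(\mathbf M;\mathbf M\mathbf x^k-\mathbf A^\top\mathbf p^k)$, $\mathbf a^{k+1}=P_g(\mathbf\Omega;\mathbf\Omega\mathbf a^k+\mathbf p^k)$, $\mathbf p^{k+1}=\mathbf p^k+\mathbf\Gamma(\mathbf A(2\mathbf x^{k+1}-\mathbf x^k)-(2\mathbf a^{k+1}-\mathbf a^k))$.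 Condition: $\mathbf M,\mathbf\Omega,\mathbf\Gamma\in\mathbb S_{++}$, $\mathbf\Gamma^{-1}\succ\mathbf A\mathbf M^{-1}\mathbf A^\top+\mathbf\Omega^{-1}$. LAG-II: $\mathcal Q=\begin{bmatrix}\mathbf M&0&0\\0&\mathbf\Omega&-\mathbf I\\0&-\mathbf I&\mathbf\Gamma^{-1}\end{bmatrix}$, $\mathcal M=\mathbf I$; i.e. $\mathbf x^{k+1}=P_f(\mathbf M+\mathbf A^\top\mathbf\Gamma\mathbf A;\mathbf M\mathbf x^k+\mathbf A^\top\mathbf\Gamma\mathbf a^k-\mathbf A^\top\mathbf p^k)$, $\mathbf p^{k+1}=\mathbf p^k+\mathbf\Gamma(\mathbf A\mathbf x^{k+1}-\mathbf a^k)$, $\mathbf a^{k+1}=P_g(\mathbf\Omega;\mathbf\Omega\mathbf a^k+2\mathbf p^{k+1}-\mathbf p^k)$. Condition: $\mathbf M\in\mathbb S_+$, $\mathbf\Omega,\mathbf\Gamma\in\mathbb S_{++}$, $\mathbf\Omega\succ\mathbf\Gamma$. LAG-III: $\mathcal Q=\begin{bmatrix}\mathbf M&0&0\\0&\mathbf\Omega&\mathbf I\\0&0&\mathbf\Gamma^{-1}\end{bmatrix}$, $\mathcal M=\begin{bmatrix}\mathbf I&0&0\\0&\mathbf I&0\\0&-\mathbf\Gamma&\mathbf I\end{bmatrix}$; i.e. $\mathbf a^{k+1}=P_g(\mathbf\Omega;\mathbf\Omega\mathbf a^k+\mathbf p^k)$, $\mathbf x^{k+1}=P_f(\mathbf M+\mathbf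 A^\top\mathbf\Gamma\mathbf A;\mathbf M\mathbf x^k-\mathbf A^\top\mathbf p^k+\mathbf A^\top\mathbf\Gamma\mathbf a^{k+1})$, $\mathbf p^{k+1}=\mathbf p^k+\mathbf\Gamma(\mathbf A\mathbf x^{k+1}+\mathbf a^k-2\mathbf a^{k+1})$. Condition: same as LAG-II. LAG-IV: $\mathcal Q=\begin{bmatrix}\mathbf M&0&-\mathbf A^\top\\0&\mathbf\Omega&0\\0&0&\mathbf\Gamma^{-1}\end{bmatrix}$, $\mathcal M=\begin{bmatrix}\mathbf I&0&0\\0&\mathbf I&0\\\mathbf\Gamma\mathbf A&0&\mathbf I\end{bmatrix}$; i.e. $\mathbf x^{k+1}=P_f(\mathbf M;\mathbf M\mathbf x^k-\mathbf A^\top\mathbf p^k)$, $\mathbf a^{k+1}=P_g(\mathbf\Omega+\mathbf\Gamma;\mathbf\Omega\mathbf a^k+\mathbf\Gamma\mathbf A\mathbf x^{k+1}+\mathbf p^k)$, $\mathbf p^{k+1}=\mathbf p^k+\mathbf\Gamma(\mathbf A(2\mathbf x^{k+1}-\mathbf x^k)-\mathbf a^{k+1})$. Condition: $\mathbf M,\mathbf\Gamma\in\mathbb S_{++}$, $\mathbf\Omega\in\mathbb S_+$, $\mathbf M\succ\mathbf A^\top\mathbf\Gamma\mathbf A$. LAG-V: $\mathcal Q=\begin{bmatrix}\mathbf M+\mathbf A^\top\mathbf\Gamma\mathbf A&0&0\\0&\mathbf\Omega+\mathbf\Gamma&0\\\mathbf A&-\mathbf I&\mathbf\Gamma^{-1}\end{bmatrix}$,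 $\mathcal M=\begin{bmatrix}\mathbf I&0&0\\0&\mathbf I&0\\\mathbf\Gamma\mathbf A&-\mathbf\Gamma&\mathbf I\end{bmatrix}$; i.e. $\mathbf x^{k+1}=P_f(\mathbf M+\mathbf A^\top\mathbf\Gamma\mathbf A;\mathbf M\mathbf x^k+\mathbf A^\top\mathbf\Gamma\mathbf a^k-\mathbf A^\top\mathbf p^k)$, $\mathbf a^{k+1}=P_g(\mathbf\Omega+\mathbf\Gamma;\mathbf\Omega\mathbf a^k+\mathbf\Gamma\mathbf A\mathbf x^k+\mathbf p^k)$, $\mathbf p^{k+1}=\mathbf p^k+\mathbf\Gamma(\mathbf A\mathbf x^{k+1}-\mathbf a^{k+1})$. Condition: $\mathbf M,\mathbf\Omega,\mathbf\Gamma\in\mathbb S_{++}$, $\mathbf M\succ\mathbf A^\top\mathbf\Gamma\mathbf\Omega^{-1}\mathbf\Gamma\mathbf A$. LAG-VI: $\mathcal Q=\begin{bmatrix}\mathbf M&0&0\\0&\mathbf\Omega+\mathbf\Gamma&0\\0&-\mathbf I&\mathbf\Gamma^{-1}\end{bmatrix}$, $\mathcal M=\begin{bmatrix}\mathbf I&0&0\\0&\mathbf I&0\\0&-\mathbf\Gamma&\mathbf I\end{bmatrix}$; i.e. $\mathbf x^{k+1}=P_f(\mathbf M+\mathbf A^\top\mathbf\Gamma\mathbf A;\mathbf M\mathbf x^k+\mathbf A^\top\mathbf\Gamma\mathbf a^k-\mathbf A^\top\mathbf p^k)$, $\mathbf a^{k+1}=P_g(\mathbf\Omega+\mathbf\Gamma;\mathbf\Omega\mathbf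 a^k+\mathbf\Gamma\mathbf A\mathbf x^{k+1}+\mathbf p^k)$, $\mathbf p^{k+1}=\mathbf p^k+\mathbf\Gamma(\mathbf A\mathbf x^{k+1}-\mathbf a^{k+1})$. Condition: $\mathbf M,\mathbf\Omega\in\mathbb S_+$, $\mathbf\Gamma\in\mathbb S_{++}$. LAG-VII: $\mathcal Q=\begin{bmatrix}\mathbf M&0&-\mathbf A^\top\\0&\mathbf\Omega&\mathbf I\\\mathbf A&-\mathbf I&\mathbf\Gamma^{-1}\end{bmatrix}$, $\mathcal M=\begin{bmatrix}\mathbf I&0&-\mathbf M^{-1}\mathbf A^\top\\0&\mathbf I&\mathbf\Omega^{-1}\\\mathbf\Gamma\mathbf A&-\mathbf\Gamma&\mathbf I\end{bmatrix}$; i.e. $\tilde{\mathbf x}^k=P_f(\mathbf M;\mathbf M\mathbf x^k-\mathbf A^\top\mathbf p^k)$, $\tilde{\mathbf a}^k=P_g(\mathbf\Omega;\mathbf\Omega\mathbf a^k+\mathbf p^k)$, $\mathbf x^{k+1}=\tilde{\mathbf x}^k-\mathbf M^{-1}\mathbf A^\top\mathbf\Gamma(\mathbf A\mathbf x^k-\mathbf a^k)$, $\mathbf a^{k+1}=\tilde{\mathbf a}^k+\mathbf\Omega^{-1}\mathbf\Gamma(\mathbf A\mathbf x^k-\mathbf a^k)$, $\mathbf p^{k+1}=\mathbf p^k+\mathbf\Gamma(\mathbf A\tilde{\mathbf x}^k-\tilde{\mathbf a}^k)$. Condition: $\mathbf M,\mathbf\Omega,\mathbf\Gamma\in\mathbb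 S_{++}$, $\mathbf\Gamma^{-1}\succ\mathbf A\mathbf M^{-1}\mathbf A^\top+\mathbf\Omega^{-1}$. *)

(* Defs.v *)
From HB Require Import structures.
From mathcomp Require Import all_boot all_order all_algebra.
From mathcomp Require Import all_classical all_reals all_analysis.

Set Implicit Arguments.
Unset Strict Implicit.
Unset Printing Implicit Defensive.

Import Order.TTheory GRing.Theory Num.Theory.
Import numFieldNormedType.Exports.

Local Open Scope classical_set_scope.
Local Open Scope ring_scope.

Section Euclidean.
Variables (R : realType) (n : nat).
Implicit Types (u v x y : 'cV[R]_n) (X : 'M[R]_n) (f : 'cV[R]_n -> \bar R).

Definition dotp u v : R := (u^T *m v) 0 0.

(* <u, X u>; a seminorm squared only when X is positive semidefinite. *)
Definition sqnorm X u : R := dotp u (X *m u).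

Definition psdmx X := X^T = X /\ forall u, 0 <= sqnorm X u.
Definition pdmx X := X^T = X /\ forall u, u != 0 -> 0 < sqnorm X u.

(* The first clause says that f takes its values in R `|` {+oo}. *)
Definition proper_fun f :=
  (forall x, f x != -oo%E) /\ (exists x, f x != +oo%E).

(* At the endpoints t = 0, 1 the convention 0 * +oo = 0 makes this trivial. *)
Definition convex_efun f := forall x y (t : R), 0 <= t <= 1 ->
  (f (t *: x + (1 - t) *: y)%R <= t%:E * f x + (1 - t)%:E * f y)%E.

Definition subdiff f x : set 'cV[R]_n :=
  [set u | forall y, (f x + (dotp u (y - x))%:E <= f y)%E].

(* Zeros of a set-valued operator. *)
Definition zer (T : 'cV[R]_n -> set 'cV[R]_n) : set 'cV[R]_n :=
  [set x | T x 0].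

(* 0 \in T (ct k) + Q (ct k - c k) and c k.+1 = c k + P (ct k - c k). *)
Definition gppa (T : 'cV[R]_n -> set 'cV[R]_n) (Q P : 'M[R]_n)
    (c ct : nat -> 'cV[R]_n) := forall k,
  [set w + Q *m (ct k - c k) | w in T (ct k)] 0 /\
  c k.+1 = c k + P *m (ct k - c k).

End Euclidean.

Section Lagrangian.
Variables (R : realType) (n m : nat).
Variables (f : 'cV[R]_n -> \bar R) (g : 'cV[R]_m -> \bar R) (A : 'M[R]_(m, n)).

(* A primal-dual point c = (x, a, p) is a stacked column vector. *)
Definition col3 (x : 'cV[R]_n) (a p : 'cV[R]_m) : 'cV[R]_(n + (m + m)) :=
  col_mx x (col_mx a p).
Definition xpart (c : 'cV[R]_(n + (m + m))) : 'cV[R]_n := usubmx c.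
Definition apart (c : 'cV[R]_(n + (m + m))) : 'cV[R]_m := usubmx (dsubmx c).
Definition ppart (c : 'cV[R]_(n + (m + m))) : 'cV[R]_m := dsubmx (dsubmx c).

(* Arguments in row-major order. *)
Definition block3
    (Xxx : 'M[R]_n) (Xxa Xxp : 'M[R]_(n, m))
    (Xax : 'M[R]_(m, n)) (Xaa Xap : 'M[R]_m)
    (Xpx : 'M[R]_(m, n)) (Xpa Xpp : 'M[R]_m) : 'M[R]_(n + (m + m)) :=
  block_mx Xxx (row_mx Xxa Xxp) (col_mx Xax Xpx) (block_mx Xaa Xap Xpa Xpp).

Definition prod3 (B1 : set 'cV[R]_n) (B2 B3 : set 'cV[R]_m) :
    set 'cV[R]_(n + (m + m)) :=
  [set c | [/\ B1 (xpart c), B2 (apart c) & B3 (ppart c)]].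

Definition lagrangian (x : 'cV[R]_n) (a p : 'cV[R]_m) : \bar R :=
  (f x + g a + (dotp p (A *m x - a))%:E)%E.

(* When B1 and B2 are nonempty and bounded and f, g are proper, lsc and convex,
   the infimum is not -oo; it is +oo when B1 `*` B2 misses dom f `*` dom g.
   If moreover B3 is nonempty and bounded, and f (xpart c), g (apart c) are
   finite, the supremum is finite, so the subtraction is never oo - oo.
   If one of B1, B2, B3 is empty, the gap is -oo (-oo absorbs in adde). *)
Definition pd_gap (B1 : set 'cV[R]_n) (B2 B3 : set 'cV[R]_m)
    (c : 'cV[R]_(n + (m + m))) : \bar R :=
  (ereal_sup [set lagrangian (xpart c) (apart c) p | p in B3] -
   ereal_inf [set lagrangian x a (ppart c) | x in B1 & a in B2])%E.

Definition kkt_op (c : 'cV[R]_(n + (m + m))) : set 'cV[R]_(n + (m + m)) :=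
  [set col3 (u + A^T *m ppart c) (v - ppart c) (- (A *m xpart c) + apart c)
     | u in subdiff f (xpart c) & v in subdiff g (apart c)].

End Lagrangian.

Inductive lag_scheme :=
  LAG_I | LAG_II | LAG_III | LAG_IV | LAG_V | LAG_VI | LAG_VII.

Section Schemes.
Variables (R : realType) (n m : nat) (A : 'M[R]_(m, n)).
Variables (M : 'M[R]_n) (Om Ga : 'M[R]_m).

Definition lag_Q (s : lag_scheme) : 'M[R]_(n + (m + m)) :=
  match s with
  | LAG_I   => block3 M     0     (- A^T)
                      0     Om    1%:M
                      (- A) 1%:M  (invmx Ga)
  | LAG_II  => block3 M     0         0
                      0     Om        (- 1%:M)
                      0     (- 1%:M)  (invmx Ga)
  | LAG_III => block3 M     0     0
                      0     Om    1%:M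
                      0     0     (invmx Ga)
  | LAG_IV  => block3 M     0     (- A^T)
                      0     Om    0
                      0     0     (invmx Ga)
  | LAG_V   => block3 (M + A^T *m Ga *m A)  0          0
                      0                     (Om + Ga)  0
                      A                     (- 1%:M)   (invmx Ga)
  | LAG_VI  => block3 M     0          0
                      0     (Om + Ga)  0
                      0     (- 1%:M)   (invmx Ga)
  | LAG_VII => block3 M     0         (- A^T)
                      0     Om        1%:M
                      A     (- 1%:M)  (invmx Ga)
  end.

Definition lag_M (s : lag_scheme) : 'M[R]_(n + (m + m)) :=
  match s with
  | LAG_I | LAG_II => 1%:M
  | LAG_III => block3 1%:M       0       0
                      0          1%:M    0
                      0          (- Ga)  1%:M
  | LAG_IV  => block3 1%:M       0       0
                      0          1%:M    0
                      (Ga *m A)  0       1%:M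
  | LAG_V   => block3 1%:M       0       0
                      0          1%:M    0
                      (Ga *m A)  (- Ga)  1%:M
  | LAG_VI  => block3 1%:M       0       0
                      0          1%:M    0
                      0          (- Ga)  1%:M
  | LAG_VII => block3 1%:M       0       (- (invmx M *m A^T))
                      0          1%:M    (invmx Om)
                      (Ga *m A)  (- Ga)  1%:M
  end.

(* lag_M s is invertible: it is unitriangular except for LAG_VII, where
   invertibility follows from lag_cond LAG_VII. *)
Definition lag_S (s : lag_scheme) : 'M[R]_(n + (m + m)) :=
  lag_Q s *m invmx (lag_M s).

Definition lag_cond (s : lag_scheme) : Prop :=
  match s with
  | LAG_I | LAG_VII =>
      [/\ pdmx M, pdmx Om, pdmx Ga &
          pdmx (invmx Ga - (A *m invmx M *m A^T + invmx Om))]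
  | LAG_II | LAG_III =>
      [/\ psdmx M, pdmx Om, pdmx Ga & pdmx (Om - Ga)]
  | LAG_IV =>
      [/\ pdmx M, pdmx Ga, psdmx Om & pdmx (M - A^T *m Ga *m A)]
  | LAG_V =>
      [/\ pdmx M, pdmx Om, pdmx Ga &
          pdmx (M - A^T *m Ga *m invmx Om *m Ga *m A)]
  | LAG_VI =>
      [/\ psdmx M, psdmx Om & pdmx Ga]
  end.

End Schemes.

(* Main.v *)
Require Import Defs.
From mathcomp Require Import all_boot all_order all_algebra.
From mathcomp Require Import all_classical all_reals all_analysis.
From mathcomp Require Import ring lra.

(* For w in the KKT operator at ct, the subgradient inequalities say that
   L(ct.x, ct.a, p) - L(x, a, ct.p) <= <w, ct - c> for every c = (x, a, p).
   Along the iteration w = - Q d with d = ct k - c k, and Q = S P with S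
   symmetric positive semidefinite; if moreover <P d, Q d> <= 2 <d, Q d>, then
   2 <w, ct k - c> <= |c k - c|_S^2 - |c (k+1) - c|_S^2.  Telescoping and
   Jensen's inequality give the 1/(2k) bound.  In each scheme both requirements
   on S, P, Q come from the inequality
   2 <u, v> <= <u, X u> + <v, X^-1 v> for X positive definite, which plays the
   role of Schur complements. *)

Import Order.TTheory GRing.Theory Num.Theory.
Import numFieldNormedType.Exports.
Local Open Scope classical_set_scope.
Local Open Scope ring_scope.

(** * Inner products, quadratic forms and positive definite matrices *)

Section Dot.
Local Set Implicit Arguments.
Local Unset Strict Implicit.
Context {R : realType}.

Lemma dotpE (n : nat) (u v : 'cV[R]_n) : dotp u v = \sum_i u i 0 * v i 0.
Proof. by rewrite /dotp mxE; apply: eq_bigr => i _; rewrite mxE. Qed.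

Lemma dotpC (n : nat) (u v : 'cV[R]_n) : dotp u v = dotp v u.
Proof. by rewrite !dotpE; apply: eq_bigr => i _; rewrite mulrC. Qed.

Lemma dotpDr (n : nat) (u v w : 'cV[R]_n) :
  dotp u (v + w) = dotp u v + dotp u w.
Proof. by rewrite /dotp mulmxDr mxE. Qed.

Lemma dotpDl (n : nat) (u v w : 'cV[R]_n) :
  dotp (u + v) w = dotp u w + dotp v w.
Proof. by rewrite !(dotpC _ w) dotpDr. Qed.

Lemma dotpNr (n : nat) (u v : 'cV[R]_n) : dotp u (- v) = - dotp u v.
Proof. by rewrite /dotp mulmxN mxE. Qed.

Lemma dotpNl (n : nat) (u v : 'cV[R]_n) : dotp (- u) v = - dotp u v.
Proof. by rewrite dotpC dotpNr dotpC. Qed.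

Lemma dotpZr (n : nat) (a : R) (u v : 'cV[R]_n) :
  dotp u (a *: v) = a * dotp u v.
Proof. by rewrite /dotp -scalemxAr mxE. Qed.

Lemma dotpZl (n : nat) (a : R) (u v : 'cV[R]_n) :
  dotp (a *: u) v = a * dotp u v.
Proof. by rewrite dotpC dotpZr dotpC. Qed.

Lemma dotp0r (n : nat) (u : 'cV[R]_n) : dotp u 0 = 0.
Proof. by rewrite /dotp mulmx0 mxE. Qed.

Lemma dotp0l (n : nat) (u : 'cV[R]_n) : dotp 0 u = 0.
Proof. by rewrite dotpC dotp0r. Qed.

Lemma dotp_suml (n : nat) (I : Type) (r : seq I) (F : I -> 'cV[R]_n)
    (v : 'cV[R]_n) : dotp (\sum_(i <- r) F i) v = \sum_(i <- r) dotp (F i) v.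
Proof.
elim/big_rec2: _ => [|i x y _ <-]; [exact: dotp0l | exact: dotpDl].
Qed.

Lemma dotp_sumr (n : nat) (I : Type) (r : seq I) (F : I -> 'cV[R]_n)
    (v : 'cV[R]_n) : dotp v (\sum_(i <- r) F i) = \sum_(i <- r) dotp v (F i).
Proof. by rewrite dotpC dotp_suml; apply: eq_bigr => i _; rewrite dotpC. Qed.

Lemma dotp_mull (n m : nat) (B : 'M[R]_(m, n)) (u : 'cV[R]_n) (v : 'cV[R]_m) :
  dotp (B *m u) v = dotp u (B^T *m v).
Proof. by rewrite /dotp trmx_mul mulmxA. Qed.

Definition dotpE_lin := (dotpDl, dotpDr, dotpNl, dotpNr, dotp0l, dotp0r).

Lemma dotp_symC (n : nat) (X : 'M[R]_n) (u v : 'cV[R]_n) :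
  X^T = X -> dotp u (X *m v) = dotp v (X *m u).
Proof. by move=> sX; rewrite dotpC dotp_mull sX. Qed.

(** A row vector killed by [X^T] on the right is the transpose of a kernel vector of [X], so [X^T]
    is row free. *)
Lemma unitmx_inj (n : nat) (X : 'M[R]_n) :
  (forall v : 'cV[R]_n, X *m v = 0 -> v = 0) -> X \in unitmx.
Proof.
move=> X0; rewrite -unitmx_tr -row_free_unit; apply: inj_row_free => v vX.
apply: trmx_inj; rewrite trmx0; apply: X0.
by rewrite -[X]trmxK -trmx_mul vX trmx0.
Qed.

(** Testing on [delta_mx j 0] recovers column [j]. This reduces factorisations of block matrices to
    identities on stacked vectors. *)
Lemma mulmx_comp (n m p : nat) (X : 'M[R]_(m, n)) (Y : 'M[R]_(m, p))
    (Z : 'M[R]_(p, n)) :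
  (forall v : 'cV[R]_n, X *m v = Y *m (Z *m v)) -> X = Y *m Z.
Proof.
move=> XYZ; apply/matrixP => i j.
by have /matrixP/(_ i 0) := XYZ (delta_mx j 0); rewrite mulmxA -!colE !mxE.
Qed.

Lemma pdmx_psd (n : nat) (X : 'M[R]_n) : pdmx X -> psdmx X.
Proof.
move=> [sX pX]; split=> // u; have [->|/pX/ltW//] := eqVneq u 0.
by rewrite /sqnorm dotp0l.
Qed.

Lemma pdmx_unit (n : nat) (X : 'M[R]_n) : pdmx X -> X \in unitmx.
Proof.
move=> [_ pX]; apply: unitmx_inj => v Xv; apply/eqP/negPn/negP => /pX.
by rewrite /sqnorm Xv dotp0r ltxx.
Qed.

Lemma sqnormD (n : nat) (X Y : 'M[R]_n) (u : 'cV[R]_n) :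
  sqnorm (X + Y) u = sqnorm X u + sqnorm Y u.
Proof. by rewrite /sqnorm mulmxDl dotpDr. Qed.

Lemma sqnormN (n : nat) (X : 'M[R]_n) (u : 'cV[R]_n) :
  sqnorm (- X) u = - sqnorm X u.
Proof. by rewrite /sqnorm mulNmx dotpNr. Qed.

Lemma sqnorm_congr (n m : nat) (X : 'M[R]_m) (B : 'M[R]_(m, n)) (u : 'cV[R]_n) :
  sqnorm (B^T *m X *m B) u = sqnorm X (B *m u).
Proof. by rewrite /sqnorm dotp_mull !mulmxA. Qed.

Lemma sqnorm_vN (n : nat) (X : 'M[R]_n) (u : 'cV[R]_n) :
  sqnorm X (- u) = sqnorm X u.
Proof. by rewrite /sqnorm mulmxN dotpNl dotpNr opprK. Qed.

Lemma invmx_sym (n : nat) (X : 'M[R]_n) : X^T = X -> (invmx X)^T = invmx X.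
Proof. by move=> sX; rewrite trmx_inv sX. Qed.

Lemma pdmx_inv (n : nat) (X : 'M[R]_n) : pdmx X -> pdmx (invmx X).
Proof.
move=> pX; have uX := pdmx_unit pX; have [sX pX'] := pX.
split=> [|u u0]; first exact: invmx_sym.
have -> : sqnorm (invmx X) u = sqnorm X (invmx X *m u).
  by rewrite /sqnorm mulKVmx // dotpC.
apply: pX'; apply: contra_neq u0 => u0.
by rewrite -[u](mulKVmx uX) u0 mulmx0.
Qed.

(** Expand 0 <= |u - X^-1 v|_X^2. *)
Lemma fenchel_young (n : nat) (X : 'M[R]_n) (u v : 'cV[R]_n) :
  pdmx X -> 2 * dotp u v <= sqnorm X u + sqnorm (invmx X) v.
Proof.
move=> pX; have uX := pdmx_unit pX; have [sX qX] := pdmx_psd pX.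
have := qX (u - invmx X *m v); rewrite /sqnorm mulmxBr mulKVmx //.
rewrite !dotpE_lin (dotp_mull (invmx X)) invmx_sym // mulKmx //.
rewrite (dotpC v u) (dotp_mull (invmx X)) invmx_sym //; lra.
Qed.

End Dot.

(** * Calculus of stacked vectors and 3 x 3 block matrices *)

Section Stack.
Local Set Implicit Arguments.
Local Unset Strict Implicit.
Context {R : realType} {n m : nat}.

Lemma col3_eta (c : 'cV[R]_(n + (m + m))) :
  c = col3 (xpart c) (apart c) (ppart c).
Proof. by rewrite /col3 !vsubmxK. Qed.

Lemma xpart_col3 (x : 'cV[R]_n) (a p : 'cV[R]_m) : xpart (col3 x a p) = x.
Proof. exact: col_mxKu. Qed.

Lemma apart_col3 (x : 'cV[R]_n) (a p : 'cV[R]_m) : apart (col3 x a p) = a.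
Proof. by rewrite /apart col_mxKd col_mxKu. Qed.

Lemma ppart_col3 (x : 'cV[R]_n) (a p : 'cV[R]_m) : ppart (col3 x a p) = p.
Proof. by rewrite /ppart !col_mxKd. Qed.

Definition part_col3 := (xpart_col3, apart_col3, ppart_col3).

Lemma col3_inj (x x' : 'cV[R]_n) (a a' p p' : 'cV[R]_m) :
  col3 x a p = col3 x' a' p' -> [/\ x = x', a = a' & p = p'].
Proof. by move=> /eq_col_mx[-> /eq_col_mx[-> ->]]. Qed.

Lemma col3D (x x' : 'cV[R]_n) (a a' p p' : 'cV[R]_m) :
  col3 x a p + col3 x' a' p' = col3 (x + x') (a + a') (p + p').
Proof. by rewrite /col3 !add_col_mx. Qed.

Lemma col3N (x : 'cV[R]_n) (a p : 'cV[R]_m) :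
  - col3 x a p = col3 (- x) (- a) (- p).
Proof. by rewrite /col3 !opp_col_mx. Qed.

Lemma col3_0 : col3 0 0 0 = 0 :> 'cV[R]_(n + (m + m)).
Proof. by rewrite /col3 !col_mx0. Qed.

Lemma dotp_col3 (x x' : 'cV[R]_n) (a a' p p' : 'cV[R]_m) :
  dotp (col3 x a p) (col3 x' a' p') = dotp x x' + dotp a a' + dotp p p'.
Proof. by rewrite /dotp /col3 !tr_col_mx !mul_row_col !mxE addrA. Qed.

Lemma mul_block3 (Xxx : 'M[R]_n) (Xxa Xxp : 'M[R]_(n, m))
    (Xax : 'M[R]_(m, n)) (Xaa Xap : 'M[R]_m)
    (Xpx : 'M[R]_(m, n)) (Xpa Xpp : 'M[R]_m) x a p :
  block3 Xxx Xxa Xxp Xax Xaa Xap Xpx Xpa Xpp *m col3 x a p =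
  col3 (Xxx *m x + Xxa *m a + Xxp *m p) (Xax *m x + Xaa *m a + Xap *m p)
       (Xpx *m x + Xpa *m a + Xpp *m p).
Proof.
rewrite /block3 /col3 mul_block_col mul_row_col mul_col_mx mul_block_col.
by rewrite add_col_mx !addrA.
Qed.

Lemma tr_block3 (Xxx : 'M[R]_n) (Xxa Xxp : 'M[R]_(n, m))
    (Xax : 'M[R]_(m, n)) (Xaa Xap : 'M[R]_m)
    (Xpx : 'M[R]_(m, n)) (Xpa Xpp : 'M[R]_m) :
  (block3 Xxx Xxa Xxp Xax Xaa Xap Xpx Xpa Xpp)^T =
  block3 Xxx^T Xax^T Xpx^T Xxa^T Xaa^T Xpa^T Xxp^T Xap^T Xpp^T.
Proof. by rewrite /block3 !tr_block_mx tr_row_mx tr_col_mx. Qed.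

End Stack.

(** * Matrix conditions, verified for each of the seven schemes *)

Section Schemes.
Local Set Implicit Arguments.
Local Unset Strict Implicit.
Context {R : realType} {n m : nat}.
Variables (A : 'M[R]_(m, n)) (M : 'M[R]_n) (Om Ga : 'M[R]_m).

(* lag_S without the inverse of lag_M: the closed form of lag_Q * lag_M^-1. *)
Definition lag_metric (s : lag_scheme) : 'M[R]_(n + (m + m)) :=
  match s with
  | LAG_I   => block3 M     0     (- A^T)
                      0     Om    1%:M
                      (- A) 1%:M  (invmx Ga)
  | LAG_II  => block3 M     0         0
                      0     Om        (- 1%:M)
                      0     (- 1%:M)  (invmx Ga)
  | LAG_III => block3 M     0          0
                      0     (Om + Ga)  1%:M
                      0     1%:M       (invmx Ga)
  | LAG_IV  => block3 (M + A^T *m Ga *m A)  0   (- A^T)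
                      0                     Om  0
                      (- A)                 0   (invmx Ga)
  | LAG_V   => block3 (M + A^T *m Ga *m A)  0          0
                      0                     (Om + Ga)  0
                      0                     0          (invmx Ga)
  | LAG_VI  => block3 M  0          0
                      0  (Om + Ga)  0
                      0  0          (invmx Ga)
  | LAG_VII => block3 M  0   0
                      0  Om  0
                      0  0   (invmx Ga)
  end.

Lemma lag_cond_Ga s : lag_cond A M Om Ga s -> pdmx Ga.
Proof. by case: s => -[]. Qed.

Lemma lag_cond_M s : lag_cond A M Om Ga s -> psdmx M.
Proof. by case: s => -[] // /pdmx_psd. Qed.

Lemma lag_cond_Om s : lag_cond A M Om Ga s -> psdmx Om.
Proof. by case: s => -[] // _ /pdmx_psd. Qed.

Let mul_simp := (mul0mx, mul1mx, mulmx0, mulmx1, add0r, addr0, oppr0).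

Lemma lag_QE s : lag_cond A M Om Ga s ->
  lag_Q A M Om Ga s = lag_metric s *m lag_M A M Om Ga s.
Proof.
move=> cond; have uG := pdmx_unit (lag_cond_Ga cond).
case: s cond => [_|_|_|_|_|_|[pM pO _ _]] /=.
- by rewrite mulmx1.
- by rewrite mulmx1.
all: apply: mulmx_comp => v; rewrite (col3_eta v) !mul_block3 !mul_simp.
all: congr col3; rewrite !(mulNmx, mulmxDl, mulmxDr, mulmxN, mulmxA).
all: rewrite ?(mulVmx uG) ?mulmxV ?pdmx_unit ?mul_simp //.
all: by apply/matrixP => i j; rewrite !mxE; ring.
Qed.

(** Trivial kernel: for LAG-III to LAG-VI by forward substitution. For LAG-VII a kernel vector has x
    = M^-1 A^T p and a = - Om^-1 p, so its last row gives |p|_{Ga^-1}^2 = - <p, (A M^-1 A^T + Om^-1)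
    p> <= 0, whence p = 0. *)
Lemma lag_M_unit s : lag_cond A M Om Ga s -> lag_M A M Om Ga s \in unitmx.
Proof.
case: s => cond /=; rewrite ?unitmx1 //; apply: unitmx_inj => v.
all: rewrite (col3_eta v) mul_block3 -col3_0 !mul_simp.
1-4: by move=> /col3_inj[-> ->]; rewrite !mul_simp => ->.
have [pM pO pG _] := cond; have uG := pdmx_unit pG.
set x := xpart v; set a := apart v; set p := ppart v => /col3_inj[eqx eqa eqp].
have x_p : x = invmx M *m (A^T *m p).
  by apply/eqP; rewrite mulmxA -subr_eq0 -mulNmx eqx.
have a_p : a = - (invmx Om *m p) by apply/eqP; rewrite -addr_eq0 eqa.
have p_xa : Ga *m (A *m x - a) = - p.
  by apply/eqP; rewrite -addr_eq0 mulmxBr mulmxA -mulNmx eqp.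
have invG_p : sqnorm (invmx Ga) p = - dotp p (A *m x - a).
  by rewrite -dotpNr -[A *m x - a](mulKmx uG) p_xa mulmxN opprK.
have p0 : p = 0.
  apply/eqP/negPn/negP => /(pdmx_inv pG).2; rewrite invG_p a_p opprK.
  rewrite dotpDr -[A in A *m x]trmxK -dotp_mull x_p.
  have := (pdmx_psd (pdmx_inv pM)).2 (A^T *m p).
  have := (pdmx_psd (pdmx_inv pO)).2 p; rewrite /sqnorm; lra.
by rewrite x_p a_p p0 !mulmx0 oppr0.
Qed.

(** Apply [fenchel_young] to (x, A^T p) with M and to (a, -p) with Om; the two dual terms add up to
    the form of A M^-1 A^T + Om^-1 at p, which Ga^-1 dominates. *)
Lemma lag_schur x a p : pdmx M -> pdmx Om ->
  pdmx (invmx Ga - (A *m invmx M *m A^T + invmx Om)) ->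
  2 * dotp p (A *m x - a) <= sqnorm M x + sqnorm Om a + sqnorm (invmx Ga) p.
Proof.
move=> pM pO /pdmx_psd[_ /(_ p)]; rewrite sqnormD sqnormN sqnormD.
rewrite -{1}[A]trmxK sqnorm_congr dotpDr dotpNr.
rewrite (dotpC p (A *m x)) dotp_mull (dotpC p a).
have := fenchel_young x (A^T *m p) pM; have := fenchel_young a (- p) pO.
rewrite sqnorm_vN dotpNr; lra.
Qed.

(** LAG-V to LAG-VII have block diagonal metrics. Elsewhere the cross terms are absorbed by
    [lag_schur] (LAG-I) or by [fenchel_young] for Ga, at (a, p) for LAG-II, (-a, p) for LAG-III and
    (A x, p) for LAG-IV. In LAG-II the resulting |a|_Ga^2 is paid for by Om - Ga. *)
Lemma lag_metric_psd s : lag_cond A M Om Ga s -> psdmx (lag_metric s).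
Proof.
move=> cond.
have [sM qM] := lag_cond_M cond; have [sO qO] := lag_cond_Om cond.
have pG := lag_cond_Ga cond; have [sG qG] := pdmx_psd pG.
have [siG qiG] := pdmx_psd (pdmx_inv pG).
split.
  have sAGA : (A^T *m Ga *m A)^T = A^T *m Ga *m A.
    by rewrite !trmx_mul trmxK sG mulmxA.
  have sN1 : (- 1%:M)^T = - 1%:M :> 'M[R]_m by rewrite linearN /= trmx1.
  have sNA : (- A)^T = - A^T by rewrite linearN.
  have sNAT : (- A^T)^T = - A by rewrite linearN /= trmxK.
  have sD k (X Y : 'M[R]_k) : (X + Y)^T = X^T + Y^T by rewrite linearD.
  by case: s cond => _ /=; rewrite tr_block3 ?sD ?sN1 ?sNA ?sNAT ?sAGA
    ?trmx1 ?trmx0 ?siG ?sM ?sO ?sG.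
move=> v; rewrite /sqnorm (col3_eta v).
set x := xpart v; set a := apart v; set p := ppart v.
have {qM}qM := qM x; have {qO}qO := qO a; have {qiG}qiG := qiG p.
have qGA := qG (A *m x); have {}qG := qG a.
have xAp : dotp x (A^T *m p) = dotp (A *m x) p by rewrite dotp_mull.
have fyG (u : 'cV[R]_m) := fenchel_young u p pG.
have pAx := dotpC p (A *m x); have pa := dotpC p a.
have AGA : dotp x (A^T *m Ga *m A *m x) = dotp (A *m x) (Ga *m (A *m x)).
  exact: sqnorm_congr.
rewrite /sqnorm in qM qO qiG qGA qG fyG.
case: s cond => cond /=; rewrite mul_block3 dotp_col3 !mul_simp
  ?(mulNmx, mulmxDl) ?mul_simp ?dotpE_lin.
- have [pM pO _ /(lag_schur x a p pM pO)] := cond.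
  rewrite /sqnorm dotpDr dotpNr; lra.
- have [_ _ _ /pdmx_psd[_ /(_ a)]] := cond; rewrite sqnormD sqnormN /sqnorm.
  have := fyG a; lra.
- have := fyG (- a); rewrite mulmxN !dotpE_lin; lra.
- have := fyG (A *m x); lra.
- lra.
- lra.
- lra.
Qed.

(** This is what makes one iteration decrease the S-distance, see [sqnorm_step]. For LAG-I and
    LAG-II, where [lag_M] is the identity, it is 0 <= <d, Q d>, the positivity of the metric.
    Otherwise the difference of the two sides is computed blockwise. *)
Lemma lag_contract s d : lag_cond A M Om Ga s ->
  dotp (lag_M A M Om Ga s *m d) (lag_Q A M Om Ga s *m d)
  <= 2 * dotp d (lag_Q A M Om Ga s *m d).
Proof.
move=> cond; have [_ /(_ d) qS] := lag_metric_psd cond.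
have [sM /(_ (xpart d)) qM] := lag_cond_M cond.
have [sO /(_ (apart d)) qO] := lag_cond_Om cond.
have pG := lag_cond_Ga cond; have uG := pdmx_unit pG.
have [siG /(_ (ppart d)) qiG] := pdmx_psd (pdmx_inv pG).
case: s cond qS => cond qS; rewrite /sqnorm /= in qM qO qiG qS *.
1-2: by rewrite mul1mx; lra.
all: clear qS; rewrite (col3_eta d); move: qM qO qiG.
all: set x := xpart d; set a := apart d; set p := ppart d => qM qO qiG.
all: have GiG u : dotp (Ga *m u) (invmx Ga *m p) = dotp u p
  by rewrite dotp_mull pG.1 mulKVmx.
all: have GC u v : dotp (Ga *m u) v = dotp v (Ga *m u) by rewrite dotpC.
all: have xAp : dotp x (A^T *m p) = dotp (A *m x) p by rewrite dotp_mull.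
all: have [pAx pa] := (dotpC p (A *m x), dotpC p a).
all: rewrite !mul_block3 !dotp_col3 !mul_simp ?(mulNmx, mulmxDl) ?mul_simp
  -?mulmxA ?dotpE_lin ?GiG ?GC.
(* LAG-III: the difference is |x|_M^2 + |a|_Om^2 + 2 <a, p> + |p|_{Ga^-1}^2. LAG-IV below is
   analogous, with A x in place of -a. *)
- have := fenchel_young (- a) p pG; have [_ _ _ /pdmx_psd[_ /(_ a)]] := cond.
  rewrite sqnorm_vN dotpNl sqnormD sqnormN /sqnorm; lra.
- have [_ _ _ /pdmx_psd[_ /(_ x)]] := cond.
  have := fenchel_young (A *m x) p pG.
  rewrite sqnormD sqnormN sqnorm_congr /sqnorm; lra.
(* LAG-V: the terms in <p, A x - a> cancel and the difference is |x|_M^2 + |a|_Om^2 + |p|_{Ga^-1}^2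
   + 2 <a, Ga A x>. The last product is split with Om, which produces the matrix A^T Ga Om^-1 Ga A
   of the condition. *)
- have [pM pO _ /pdmx_psd[_ /(_ x)]] := cond.
  have := fenchel_young (- a) (Ga *m (A *m x)) pO.
  have := dotp_symC (A *m x) a pG.1.
  have AGOGA : sqnorm (A^T *m Ga *m invmx Om *m Ga *m A) x =
      sqnorm (invmx Om) (Ga *m (A *m x)).
    by rewrite /sqnorm -!mulmxA -dotp_mull (dotp_symC _ _ pG.1) dotpC.
  rewrite sqnorm_vN dotpNl sqnormD sqnormN AGOGA.
  have -> : dotp x (A^T *m (Ga *m (A *m x))) = dotp (A *m x) (Ga *m (A *m x)).
    by rewrite -dotp_mull.
  rewrite /sqnorm; lra.
(* LAG-VI: the difference is |x|_M^2 + |a|_Om^2 + |p|_{Ga^-1}^2. *)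
- lra.
- have [pM pO _ pS] := cond.
  (* LAG-VII: with r = A x - a, the difference is |x|_M^2 + |a|_Om^2 - |r|_Ga^2 plus the form of the
     condition at p. Taking Ga r as dual variable gives 2 |r|_Ga^2 <= |x|_M^2 + |a|_Om^2 +
     |r|_Ga^2. *)
  have := lag_schur x a (Ga *m (A *m x - a)) pM pO pS.
  have [_ /(_ p)] := pdmx_psd pS.
  rewrite sqnormD sqnormN sqnormD -{1}[A]trmxK sqnorm_congr.
  have iMM : dotp (invmx M *m (A^T *m p)) (M *m x) = dotp x (A^T *m p).
    by rewrite dotp_symC // mulKVmx ?pdmx_unit.
  have iOO : dotp (invmx Om *m p) (Om *m a) = dotp a p.
    by rewrite dotp_symC // mulKVmx ?pdmx_unit.
  rewrite [sqnorm (invmx Ga) (_ *m _)]/sqnorm mulKmx // GC iMM iOO.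
  rewrite (dotpC (invmx M *m _)) (dotpC (invmx Om *m _)).
  rewrite !mulmxDr !mulmxN !dotpE_lin /sqnorm; lra.
Qed.

End Schemes.

(** * Convexity of averages and descent of the squared S-distance *)

Section Ergodic.
Context {R : realType}.
Local Set Implicit Arguments.
Local Unset Strict Implicit.

(** At a point of the domain, the subgradient inequality rules out [+oo]. *)
Lemma subdiff_fin_num (n : nat) (f : 'cV[R]_n -> \bar R) x u :
  proper_fun f -> subdiff f x u -> f x \is a fin_num.
Proof.
move=> [fNy [y fy]] /(_ y); have := fNy x.
by case: (f x) => [r||] // _; rewrite leye_eq => /eqP /(elimN eqP fy).
Qed.

Lemma convex_efun_avg (n : nat) (f : 'cV[R]_n -> \bar R) (x : nat -> 'cV[R]_n)
    (F : nat -> R) (k : nat) :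
  convex_efun f -> (forall i, f (x i) = (F i)%:E) -> (0 < k)%N ->
  (f (k%:R^-1 *: \sum_(i < k) x i) <= (k%:R^-1 * \sum_(i < k) F i)%:E)%E.
Proof.
move=> cf fx; case: k => // k _; elim: k => [|k IH].
  by rewrite !big_ord1 invr1 scale1r mul1r fx.
(* The weight of the mean of the first k+1 points in the mean of k+2 points. *)
set t : R := k.+1%:R / k.+2%:R.
have k1 : k.+1%:R != 0 :> R by rewrite pnatr_eq0.
have k2 : k.+2%:R != 0 :> R by rewrite pnatr_eq0.
have tC : 1 - t = k.+2%:R^-1 by rewrite /t -[k.+2]addn1 natrD in k2 *; field.
have t01 : 0 <= t <= 1.
  by rewrite divr_ge0 ?ler0n //= ler_pdivrMr ?ltr0n // mul1r ler_nat.
have tV : t * k.+1%:R^-1 = k.+2%:R^-1 by rewrite /t mulrAC divff // mul1r.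
have -> : k.+2%:R^-1 *: \sum_(i < k.+2) x i =
    t *: (k.+1%:R^-1 *: \sum_(i < k.+1) x i) + (1 - t) *: x k.+1.
  by rewrite scalerA tV tC -scalerDr big_ord_recr.
apply: (le_trans (cf _ _ _ t01)); rewrite tC fx.
rewrite [X in (_ <= (_ * X)%:E)%E]big_ord_recr /= mulrDr EFinD
  [X in (_ <= _ + X)%E]EFinM.
rewrite leeD2r // -tV -mulrA [X in (_ <= X)%E]EFinM.
apply: lee_wpmul2l => //.
by rewrite lee_fin; case/andP: t01.
Qed.

(** With e = c - cc and y = P d, the right side is - 2 <e, S y> - <y, S y> and the left side is - 2
    <e, S y> - 2 <d, S y>, so the claim is the assumed bound on <y, S y>. *)
Lemma sqnorm_step (n : nat) (S P : 'M[R]_n) (c d cc : 'cV[R]_n) :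
  S^T = S ->
  dotp (P *m d) (S *m P *m d) <= 2 * dotp d (S *m P *m d) ->
  2 * dotp (- (S *m P *m d)) (c + d - cc) <=
  sqnorm S (c - cc) - sqnorm S (c + P *m d - cc).
Proof.
move=> sS; set e := c - cc.
rewrite -!mulmxA !(addrAC _ _ (- cc)) -/e.
move: e => {c cc} e; set y := P *m d.
rewrite /sqnorm mulmxDr !dotpE_lin (dotp_symC y e sS).
rewrite !(dotpC (S *m y)); lra.
Qed.

(** * Lagrangian inequalities and the restricted gap *)

Context {n m : nat}.
Variables (f : 'cV[R]_n -> \bar R) (g : 'cV[R]_m -> \bar R) (A : 'M[R]_(m, n)).
Hypotheses (f_proper : proper_fun f) (g_proper : proper_fun g).

Lemma kkt_fin_num c w : kkt_op f g A c w ->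
  f (xpart c) \is a fin_num /\ g (apart c) \is a fin_num.
Proof.
by case=> u fu [v gv _]; split;
  [apply: subdiff_fin_num fu | apply: subdiff_fin_num gv].
Qed.

(** Add the subgradient inequalities of f at x and of g at a; the skew part of the operator supplies
    exactly the change in the coupling terms. If f x or g a is [+oo] the bound is trivial. *)
Lemma kkt_lagrangian_le c w x a p : kkt_op f g A c w ->
  (lagrangian f g A (xpart c) (apart c) p <=
   lagrangian f g A x a (ppart c) + (dotp w (c - col3 x a p))%:E)%E.
Proof.
move=> kw; have [fF gF] := kkt_fin_num kw.
case: kw => u /(_ x) fu [v /(_ a) gv <-]; move: fu gv; rewrite /lagrangian.
rewrite [in dotp (col3 _ _ _) _](col3_eta c) col3N col3D dotp_col3.
move: fF gF; case: (f (xpart c)) => // F _; case: (g (apart c)) => // G _.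
case: (f x) => [r||//]; case: (g a) => [s||//]; rewrite ?addey ?addye ?leey //.
rewrite -!EFinD !lee_fin.
set x' := xpart c; set a' := apart c; set p' := ppart c.
rewrite !part_col3 !(mulmxDr, mulmxN, dotpE_lin).
rewrite !(dotpC (A^T *m p')) -!dotp_mull !(dotpC _ p') !(dotpC _ p); lra.
Qed.


Lemma pd_gap_le (B1 : set 'cV[R]_n) (B2 B3 : set 'cV[R]_m) c (r : \bar R) :
  r != -oo%E ->
  (forall x a p, B1 x -> B2 a -> B3 p ->
    (lagrangian f g A (xpart c) (apart c) p <=
     lagrangian f g A x a (ppart c) + r)%E) ->
  prod3 B1 B2 B3 !=set0 -> (pd_gap f g A B1 B2 B3 c <= r)%E.
Proof.
move=> rN Lle [c0 [B1x B2a B3p]].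
case: r rN Lle => [r _||//] Lle; last by rewrite leey.
rewrite /pd_gap; set U := ereal_sup _; set I := ereal_inf _.
have UI : (U - r%:E <= I)%E.
  apply: le_ereal_inf_tmp => _ [x Bx [a Ba <-]]; rewrite leeBlDr //.
  by apply: ge_ereal_sup => _ [p Bp <-]; apply: Lle.
(* This excludes I = [-oo]: there U - r <= I would force U = [-oo]. If I = [+oo], the gap is [-oo]
   by absorption. *)
have UNy : U != -oo%E.
  rewrite -ltNye.
  apply: (@lt_le_trans _ _ (lagrangian f g A (xpart c) (apart c) (ppart c0))).
    rewrite ltNye /lagrangian; have := f_proper.1 (xpart c).
    by have := g_proper.1 (apart c); case: (f _); case: (g _).
  by apply: ereal_sup_ubound; exists (ppart c0).
move: UI; case: I => [i||]; first by rewrite leeBlDr // leeBlDr // addeC.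
  by rewrite addeNy leNye.
by rewrite leeNy_eq; case: U UNy.
Qed.

Lemma pd_gap_ge0 (B1 : set 'cV[R]_n) (B2 B3 : set 'cV[R]_m) c :
  (exists2 cs, zer (kkt_op f g A) cs & prod3 B1 B2 B3 cs) ->
  (0 <= pd_gap f g A B1 B2 B3 c)%E.
Proof.
case=> cs zcs [B1x B2a B3p].
have [fF gF] := kkt_fin_num zcs.
have := kkt_lagrangian_le (xpart c) (apart c) (ppart c) zcs.
rewrite dotp0l adde0 => Lle; rewrite /pd_gap.
set L := lagrangian _ _ _ _ _ _ in Lle.
(* Finiteness allows writing 0 as L - L; the supremum is then at least L and the infimum at most
   L. *)
have LF : L \is a fin_num.
  by rewrite /L /lagrangian -(fineK fF) -(fineK gF).
rewrite -(subee LF); apply: leeB.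
  apply: (le_trans Lle); apply: ereal_sup_ubound; by exists (ppart cs).
by apply: ereal_inf_lbound; exists (xpart cs) => //; exists (apart cs).
Qed.

(** * Ergodic rate for an abstract generalized proximal point algorithm *)

Hypotheses (f_convex : convex_efun f) (g_convex : convex_efun g).
Variables (Q P S : 'M[R]_(n + (m + m))) (c ct : nat -> 'cV[R]_(n + (m + m))).
Hypotheses (QE : Q = S *m P) (S_psd : psdmx S).
Hypothesis PQ_le : forall d, dotp (P *m d) (Q *m d) <= 2 * dotp d (Q *m d).
Hypothesis c_gen : gppa (kkt_op f g A) Q P c ct.

Let ctE i : c i + (ct i - c i) = ct i. Proof. by rewrite addrC subrK. Qed.

Lemma gppa_kkt i : kkt_op f g A (ct i) (- (Q *m (ct i - c i))).
Proof. by have [[w kw /eqP]] := c_gen i; rewrite addr_eq0 => /eqP <-. Qed.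

(** Sums [sqnorm_step] over the iterations. The arbitrary minorant [F] will be the real-valued
    Lagrangian difference at [ct i]. *)
Lemma gppa_telescope (F : nat -> R) cc k :
  (forall i, F i <= dotp (- (Q *m (ct i - c i))) (ct i - cc)) ->
  2 * \sum_(i < k) F i <= sqnorm S (c 0 - cc) - sqnorm S (c k - cc).
Proof.
move=> FQ; elim: k => [|k IH]; first by rewrite big_ord0 mulr0 subrr.
rewrite big_ord_recr /= mulrDr.
have := sqnorm_step (P := P) (d := ct k - c k) (c k) cc S_psd.1.
rewrite -QE -(c_gen k).2 ctE => /(_ (PQ_le _)); have := FQ k; lra.
Qed.

(** Jensen handles f and g, while the coupling terms are affine in the iterate and so average
    exactly. *)
Lemma gppa_lagrangian_le k x a p : (0 < k)%N ->
  let cb := k%:R^-1 *: \sum_(i < k) ct i in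
  (lagrangian f g A (xpart cb) (apart cb) p <=
   lagrangian f g A x a (ppart cb)
     + ((2 * k%:R)^-1 * sqnorm S (c 0 - col3 x a p))%:E)%E.
Proof.
move=> k0 /=; set cb := _ *: _.
pose F i := fine (f (xpart (ct i))); pose G i := fine (g (apart (ct i))).
have fF i : f (xpart (ct i)) = (F i)%:E
  by rewrite fineK // (kkt_fin_num (gppa_kkt i)).1.
have gG i : g (apart (ct i)) = (G i)%:E
  by rewrite fineK // (kkt_fin_num (gppa_kkt i)).2.
have xb : xpart cb = k%:R^-1 *: \sum_(i < k) xpart (ct i).
  by rewrite /xpart linearZ linear_sum.
have ab : apart cb = k%:R^-1 *: \sum_(i < k) apart (ct i).
  by rewrite /apart linearZ /= linear_sum /= linearZ /= linear_sum.
have pb : ppart cb = k%:R^-1 *: \sum_(i < k) ppart (ct i).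
  by rewrite /ppart linearZ /= linear_sum /= linearZ /= linear_sum.
have := f_proper.1 x; have := g_proper.1 a.
rewrite {2}/lagrangian.
case gs : (g a) => [s||//] _; case fr : (f x) => [r||//] _;
  rewrite ?addey ?addye ?leey //.
(* L(ct i; p) - L(x, a; ppart (ct i)), as a real number now that f x and g a are finite. *)
pose h i := F i + G i + dotp p (A *m xpart (ct i) - apart (ct i))
            - (r + s + dotp (ppart (ct i)) (A *m x - a)).
have hQ i : h i <= dotp (- (Q *m (ct i - c i))) (ct i - col3 x a p).
  have := kkt_lagrangian_le x a p (gppa_kkt i).
  by rewrite /lagrangian fF gG fr gs -!EFinD lee_fin /h; lra.
have hk := gppa_telescope k hQ.
have := convex_efun_avg f_convex fF k0; rewrite -xb => fb.
have := convex_efun_avg g_convex gG k0; rewrite -ab => gb.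
rewrite /lagrangian; apply: (le_trans (leeD2r _ (leeD fb gb))).
rewrite -!EFinD lee_fin.
have hE : \sum_(i < k) h i = \sum_(i < k) F i + \sum_(i < k) G i
   + k%:R * dotp p (A *m xpart cb - apart cb)
   - (k%:R * (r + s) + k%:R * dotp (ppart cb) (A *m x - a)).
  rewrite !sumrB !big_split /= -dotp_sumr -dotp_suml !sumr_const card_ord.
  rewrite sumrB -mulmx_sumr xb ab pb -scalemxAr -scalerBr dotpZr dotpZl.
  by rewrite !mulVKf ?pnatr_eq0 -?lt0n // mulrDr !mulr_natl.
(* Positivity lets the final distance left by the telescoping be dropped. *)
have := S_psd.2 (c k - col3 x a p).
set D := dotp p _ in hE *; set D' := dotp (ppart cb) _ in hE *.
set X := sqnorm S _ in hk * => Sk.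
have kp : 0 < k%:R :> R by rewrite ltr0n.
have kn0 := lt0r_neq0 kp.
rewrite -subr_le0.
suff -> : k%:R^-1 * \sum_(i < k) F i + k%:R^-1 * \sum_(i < k) G i + D -
    (r + s + D' + (2 * k%:R)^-1 * X) = k%:R^-1 * (\sum_(i < k) h i - X / 2).
  by rewrite mulr_ge0_le0 ?invr_ge0 ?ler0n //; lra.
by rewrite hE; field.
Qed.

Lemma gppa_pd_gap_le (B1 : set 'cV[R]_n) (B2 B3 : set 'cV[R]_m) k :
  (0 < k)%N ->
  (pd_gap f g A B1 B2 B3 (k%:R^-1 *: \sum_(i < k) ct i) <=
   ((2 * k%:R)^-1)%:E *
     ereal_sup [set (sqnorm S (c 0 - cc))%:E | cc in prod3 B1 B2 B3])%E.
Proof.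
move=> k0; set cb := _ *: _; set sup := ereal_sup _.
have k2 : 0 < (2 * k%:R)^-1 :> R by rewrite invr_gt0 mulr_gt0 ?ltr0n.
have sup_ge x a p : B1 x -> B2 a -> B3 p ->
    ((sqnorm S (c 0 - col3 x a p))%:E <= sup)%E.
  move=> Bx Ba Bp; apply: ereal_sup_ubound; exists (col3 x a p) => //.
  by split; rewrite part_col3.
have [B0|] := pselect (prod3 B1 B2 B3 !=set0).
  apply: pd_gap_le => // [|x a p Bx Ba Bp].
    (* The supremum dominates a real number, so it is not [-oo]; the positive factor preserves
       [+oo]. *)
    have [cc [Bx Ba Bp]] := B0; have := sup_ge _ _ _ Bx Ba Bp.
    by case: sup {sup_ge} => // _; rewrite mulry gtr0_sg // mul1e.
  apply: (le_trans (gppa_lagrangian_le x a p k0)); rewrite leeD2l // EFinM.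
  by apply: lee_wpmul2l; [rewrite lee_fin ltW | exact: sup_ge].
(* Empty product: the gap itself is [-oo], because either the infimum ranges over the empty set and
   is [+oo], or B3 is empty and the supremum is [-oo]. *)
move=> B0; rewrite /pd_gap; have [[p Bp]|] := pselect (B3 !=set0).
  rewrite [X in ereal_inf X](_ : _ = set0) ?ereal_inf0 ?addeNy ?leNye //.
  apply/seteqP; split=> // t [x Bx [a Ba _]]; case: B0.
  by exists (col3 x a p); split; rewrite part_col3.
move=> /set0P/negP/negPn/eqP ->.
by rewrite image_set0 ereal_sup0 addNye leNye.
Qed.

End Ergodic.

Theorem corollary2 (R : realType) (n m : nat)
  (f : 'cV[R]_n -> \bar R) (g : 'cV[R]_m -> \bar R) (A : 'M[R]_(m, n))
  (f_proper : proper_fun f) (f_lsc : lower_semicontinuous f)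
  (f_convex : convex_efun f)
  (g_proper : proper_fun g) (g_lsc : lower_semicontinuous g)
  (g_convex : convex_efun g)
  (M : 'M[R]_n) (Om Ga : 'M[R]_m) (s : lag_scheme)
  (s_cond : lag_cond A M Om Ga s)
  (c ct : nat -> 'cV[R]_(n + (m + m)))
  (c_gen : gppa (kkt_op f g A) (lag_Q A M Om Ga s) (lag_M A M Om Ga s) c ct)
  (B1 : set 'cV[R]_n) (B2 B3 : set 'cV[R]_m)
  (B_bounded : bounded_set (prod3 B1 B2 B3))
  (k : nat) (k_ge1 : (1 <= k)%N) :
  let gap := pd_gap f g A B1 B2 B3 (k%:R^-1 *: \sum_(i < k) ct i) in
  (gap <= ((2 * k%:R)^-1)%:E *
     ereal_sup [set (sqnorm (lag_S A M Om Ga s) (c 0%N - cc))%:E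
                  | cc in prod3 B1 B2 B3])%E /\
  ((exists2 cstar, zer (kkt_op f g A) cstar & prod3 B1 B2 B3 cstar) ->
   (0 <= gap)%E).
Proof.
move=> gap; split; last exact: pd_gap_ge0.
have uP := lag_M_unit s_cond; have QE := lag_QE s_cond.
(* Cancelling the invertible [lag_M] in the factorisation of [lag_Q] identifies S with its closed
   form. *)
have SE : lag_S A M Om Ga s = lag_metric A M Om Ga s.
  by rewrite /lag_S QE mulmxK.
rewrite SE; apply: (gppa_pd_gap_le _ _ _ _ QE (lag_metric_psd s_cond)) => // d.
exact: lag_contract.
Qed.
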